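(* Let $n\geq 1$ be an integer and let $P_1,\ldots,P_n\in\mathbb{R}[t]$ be nonzero real polynomials with $P_i(0)=0$ for $1\le i\le n$, whose degrees $d_i=\deg P_i$ are pairwise distinct. Set $\gamma(t)=(P_1(t),\ldots,P_n(t))$ and $d=\max_{1\leq i\leq n}d_i$. Then there exists a constant $c>0$ depending only on $\gamma$ such that the following holds. For every $\epsilon\in(0,1/2)$, every real $N\geq 1$, and every Lebesgue measurable set $E\subset[0,N]^n$ with $|E|\geq\epsilon N^n$, there exist $x\in\mathbb{R}^n$ and $t\in\mathbb{R}$ with $$x\in E,\qquad x+\gamma(t)\in E,\qquad t>\delta N^{1/d},$$ where $$\delta=\delta(\epsilon)=\exp\left(-\exp\left(c\,\epsilon^{-4}\right)\right).$$
   Context: $|E|$ denotes the Lebesgue measure of $E\subset\mathbb{R}^n$. *)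

(* Defs.v *)
From HB Require Import structures.
From mathcomp Require Import all_boot all_order all_algebra.
From mathcomp Require Import all_classical all_reals all_analysis.

Set Implicit Arguments.
Unset Strict Implicit.
Unset Printing Implicit Defensive.

Import Order.TTheory GRing.Theory Num.Theory.

Local Open Scope classical_set_scope.
Local Open Scope ring_scope.

Section LebesgueMeasure.
Context (R : realType) (n : nat).
Implicit Types (a b : 'rV[R]_n) (E : set 'rV[R]_n).

Definition box a b : set 'rV[R]_n :=
  [set x : 'rV[R]_n | forall i, a 0 i <= x 0 i <= b 0 i].

(* The volume of [box a b] when [a <= b] coordinatewise; otherwise [box a b] is
   empty and this product may be negative, whence the condition in
   [box_cover]. *)
Definition box_volume a b : R := \prod_(i < n) (b 0 i - a 0 i).

Definition box_cover E : set (nat -> 'rV[R]_n * 'rV[R]_n) :=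
  [set B : nat -> 'rV[R]_n * 'rV[R]_n |
    (forall k i, (B k).1 0 i <= (B k).2 0 i) /\
    E `<=` \bigcup_k box (B k).1 (B k).2].

(* MathComp-Analysis has Lebesgue measure on R only. As there, the measure on
   R^n is the outer measure given by countable covers with boxes, restricted to
   the sets that are measurable in the sense of Caratheodory. This is meant for
   n >= 1: in R^0 every box has volume 1. *)
Definition lebesgue_outer_measure E : \bar R :=
  ereal_inf [set (\sum_(k <oo) (box_volume (B k).1 (B k).2)%:E)%E
            | B in box_cover E].

Definition lebesgue_measurable E : Prop :=
  lebesgue_outer_measure.-caratheodory E.

End LebesgueMeasure.

(* The size of a polynomial is 1 + its degree. *)
Definition degree (R : realType) (p : {poly R}) : nat := (size p).-1.

Definition poly_curve (R : realType) (n : nat) (P : 'I_n -> {poly R}) (t : R) :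
  'rV[R]_n := \row_(i < n) (P i).[t].

(* Main.v *)
Require Import Defs.
From HB Require Import structures.
From mathcomp Require Import all_boot all_order all_algebra.
From mathcomp Require Import all_fingroup all_field all_character.
From mathcomp Require Import all_classical all_reals all_analysis.
From mathcomp Require Import ring lra zify.

Set Implicit Arguments.
Unset Strict Implicit.
Unset Printing Implicit Defensive.

Import Order.TTheory GRing.Theory Num.Theory.

(** The curve is a linear image of the moment curve: if [a_k] is the vector of
    the coefficients of degree [k] of the [P i], then
    [gamma t = t a_1 + t^2 a_2 + ... + t^d a_d]. Take [t = m eta] with [m] a
    positive integer and [eta] a small multiple of [N^(1/d)]. The translates of
    [E] by the points [v_z = z_1 eta a_1 + ... + z_d eta^d a_d], with integers
    [0 <= z_k < M], all stay in a cube of side [3 N], so some [x] belongs to a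
    proportion of them that is at least a constant times [eps]
    ([translates_pigeonhole]). In other words the set of [z] with [x + v_z] in
    [E] is dense in its box. Since moving [z] by [(m, m^2, ..., m^d)] moves
    [v_z] by [gamma (m eta)], it remains to find two points of a dense set of
    integer tuples that differ by such a vector, with control on [M]. This is
    a Furstenberg-Sarkozy theorem, proved here in every finite abelian group
    ([polynomial_recurrence]).

    The theorem in a group holds because the vectors [(m, m^2, ..., m^d)] form
    a van der Corput set: there is a nonnegative weight of total mass [J] on
    the integers [1 <= m <= B] such that the weighted sum of
    [Re (z_1^m z_2^(m^2) ... z_d^(m^d))] is at least [-(d + 1)] for all complex
    numbers [z_k] of modulus 1 ([stages_ge]). If a subset [S] of a group [G] had
    no two points at the required differences, the sum over all characters of
    these weighted sums, with the squared Fourier coefficients of [S] as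
    coefficients, would vanish. The trivial character contributes [J |S|^2] and
    the others at least [-(d + 1) |G| |S|], so [J |S| <= (d + 1) |G|].

    The weight is a sum of [J] uniform averages, the stages. Stage [j] averages
    over the multiples [Q^j m] with [1 <= m <= L_j], where [Q] is a large
    factorial and the lengths [L_j] decrease very fast. Consider a stage whose
    average has modulus at least [1 / J]. By van der Corput differencing, which
    makes the exponent linear, the monomial of highest degree has a base [z_k]
    whose power [z_k^s] is within a bounded multiple of [1 / L_j] of 1, for
    some bounded [s]; this [s] divides [Q] ([weyl]). In every later stage this
    monomial is then almost equal to 1, and the degree of the exponent has
    dropped. So there are at most [d] such stages; each of them costs at most 1, and all
    the other stages together cost at most 1.

    Each [L_j] is about the [d]-th power of the next one, times a constant
    exponential in a power of [J], so [B] is doubly exponential in [J]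
    ([double_exp_recurrence_bound]). As [J] is of order [1 / eps], this gives
    even [exp (- exp (c / eps))] in place of [exp (- exp (c eps^-4))]. *)

Local Open Scope ring_scope.

(** * Moduli and real parts in an ordered field *)

(** The order of [algC] is partial, but absolute values and real parts live in
    the totally ordered field of its real elements. Working with them in a type
    of their own makes linear arithmetic available for all the estimates. *)
Record algR := AlgR {algRval : algC; algRvalP : algRval \is Num.real}.
HB.instance Definition _ := [isSub for algRval].
HB.instance Definition _ := [Countable of algR by <:].
HB.instance Definition _ := [SubChoice_isSubIntegralDomain of algR by <:].
HB.instance Definition _ := [SubIntegralDomain_isSubField of algR by <:].
HB.instance Definition _ : Order.isPOrder ring_display algR :=
  Order.CancelPartial.Pcan _ valK.

Lemma algR_total : total (<=%O : rel algR).
Proof. by move=> x y; apply/real_leVge/valP/valP. Qed.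
HB.instance Definition _ := Order.POrder_isTotal.Build _ algR algR_total.

Definition algR_norm (x : algR) : algR := AlgR (normr_real (val x)).

Lemma algR_normD (x y : algR) : algR_norm (x + y) <= algR_norm x + algR_norm y.
Proof. exact: ler_normD. Qed.
Lemma algR_norm_eq0 (x : algR) : algR_norm x = 0 -> x = 0.
Proof. by move=> /(congr1 val)/= /eqP; rewrite normr_eq0 => /eqP ?; apply/val_inj. Qed.
Lemma algR_addr_gt0 (x y : algR) : 0 < x -> 0 < y -> 0 < x + y.
Proof. exact: addr_gt0. Qed.
Lemma algR_ger_leVge (x y : algR) : 0 <= x -> 0 <= y -> (x <= y) || (y <= x).
Proof. exact: ger_leVge. Qed.
Lemma algR_normM : {morph algR_norm : x y / x * y}.
Proof. by move=> x y; apply/val_inj; exact: normrM. Qed.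
Lemma algR_le_def (x y : algR) : (x <= y) = (algR_norm (y - x) == y - x).
Proof. by rewrite -val_eqE; exact: ler_def. Qed.
Lemma algR_normMn (x : algR) n : algR_norm (x *+ n) = algR_norm x *+ n.
Proof.
apply/val_inj; rewrite [RHS]raddfMn /= -normrMn.
by congr `|_|; exact: (raddfMn val).
Qed.
Lemma algR_normN (x : algR) : algR_norm (- x) = algR_norm x.
Proof. by apply/val_inj; exact: normrN. Qed.
HB.instance Definition _ := Num.Zmodule_isNormed.Build algR algR
  algR_normD algR_norm_eq0 algR_normMn algR_normN.
HB.instance Definition _ := Num.isNumRing.Build algR
  algR_addr_gt0 algR_ger_leVge algR_normM algR_le_def.

Definition modulus (x : algC) : algR := AlgR (normr_real x).
Definition repart (x : algC) : algR := AlgR (Creal_Re x).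

Lemma algRval_natr n : algRval n%:R = n%:R.
Proof. exact: (rmorph_nat val). Qed.

Lemma algRval_sum (I : finType) (F : I -> algR) :
  algRval (\sum_i F i) = \sum_i algRval (F i).
Proof. exact: (raddf_sum val). Qed.

Lemma modulusD x y : modulus (x + y) <= modulus x + modulus y.
Proof. exact: ler_normD. Qed.
Lemma modulusM x y : modulus (x * y) = modulus x * modulus y.
Proof. by apply/val_inj; exact: normrM. Qed.
Lemma modulusN x : modulus (- x) = modulus x.
Proof. by apply/val_inj; exact: normrN. Qed.
Lemma modulusB x y : modulus (x - y) = modulus (y - x).
Proof. by rewrite -modulusN opprB. Qed.
Lemma modulus_ge0 x : 0 <= modulus x.
Proof. exact: normr_ge0. Qed.
Lemma modulus0 : modulus 0 = 0.
Proof. by apply/val_inj; exact: normr0. Qed.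
Lemma modulus1 : modulus 1 = 1.
Proof. by apply/val_inj; exact: normr1. Qed.
Lemma modulus_nat n : modulus n%:R = n%:R.
Proof. by apply/val_inj; rewrite /= normr_nat algRval_natr. Qed.
Lemma modulus_conj x : modulus x^* = modulus x.
Proof. by apply/val_inj; exact: norm_conjC. Qed.
Lemma modulusX x n : modulus (x ^+ n) = modulus x ^+ n.
Proof. by elim: n => [|n IH]; rewrite ?expr0 ?modulus1 // !exprS modulusM IH. Qed.
Lemma modulus_sum (I : Type) (r : seq I) (Q : pred I) (F : I -> algC) :
  modulus (\sum_(i <- r | Q i) F i) <= \sum_(i <- r | Q i) modulus (F i).
Proof.
elim/big_rec2: _ => [|i y x _ IH]; first by rewrite modulus0.
by apply: le_trans (modulusD _ _) _; rewrite lerD2l.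
Qed.
Lemma modulus_eq1P x : reflect (modulus x = 1) (`|x| == 1).
Proof. by apply: (iffP eqP) => [h|/(congr1 val)//]; apply/val_inj. Qed.

Lemma sqr_modulus x : algRval (modulus x ^+ 2) = x * x^*.
Proof. by rewrite -normCK; exact: (rmorphXn val). Qed.

Lemma repartD x y : repart (x + y) = repart x + repart y.
Proof. by apply/val_inj; exact: raddfD. Qed.
Lemma repart0 : repart 0 = 0.
Proof. by apply/val_inj; exact: raddf0. Qed.
Lemma repart1 : repart 1 = 1.
Proof. by apply/val_inj; apply/Creal_ReP/rpred1. Qed.
Lemma repart_sum (I : Type) (r : seq I) (Q : pred I) (F : I -> algC) :
  repart (\sum_(i <- r | Q i) F i) = \sum_(i <- r | Q i) repart (F i).
Proof. by elim/big_rec2: _ => [|i y x _ <-]; rewrite ?repart0 ?repartD. Qed.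
Lemma ler_modulus_repart x : - modulus x <= repart x.
Proof.
have : `| repart x | <= modulus x by have [] := leif_normC_Re_Creal x.
by rewrite ler_norml => /andP[].
Qed.
Lemma repartMl (a : algR) z : repart (algRval a * z) = a * repart z.
Proof. by apply/val_inj; exact: (ReMl (algRvalP a)). Qed.
Lemma repart_nat n : repart n%:R = n%:R.
Proof. by apply/val_inj; rewrite /= (Creal_ReP _ (realn _ _)) algRval_natr. Qed.

(** * Polynomial phases and van der Corput differencing *)

(** A polynomial phase of degree at most [k], by recursion on multiplicative
    differences: if [u m] is [e(p(m))] with [p] a polynomial, then [w] is
    [e(k! c)], where [c] is the coefficient of degree [k] of [p]. *)
Fixpoint phase (k : nat) (w : algC) (u : nat -> algC) : Prop :=
  if k is k'.+1 then phase k' w (fun m => u m.+1 / u m) else forall m, u m = w.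

Lemma eq_phase k w u v : u =1 v -> phase k w u -> phase k w v.
Proof.
elim: k u v => [|k IH] u v uv /=; first by move=> h m; rewrite -uv.
by apply: IH => m; rewrite !uv.
Qed.

Lemma phaseM k w w' u u' : phase k w u -> phase k w' u' ->
  phase k (w * w') (fun m => u m * u' m).
Proof.
elim: k u u' => [|k IH] u u' /=; first by move=> h h' m; rewrite h h'.
by move=> hu hu'; apply: eq_phase (IH _ _ hu hu') => m; rewrite invfM mulrACA.
Qed.

Lemma phase1 k : phase k 1 (fun=> 1).
Proof. by elim: k => //= k; apply: eq_phase => m; rewrite divr1. Qed.

Lemma phase_shift k w u h : phase k w u -> phase k w (fun m => u (m + h)%N).
Proof. by elim: k u => [|k IH] u /=; [move=> hu m | move/IH]. Qed.

(** The quotient by a shift of [h] telescopes into [h] quotients by a shift of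
    one, each with the same top [w]; whence the power of [w]. *)
Lemma phase_diff k w u h : (forall m, u m != 0) -> phase k.+1 w u ->
  phase k (w ^+ h) (fun m => u (m + h)%N / u m).
Proof.
move=> u0 /= hu; elim: h => [|h IH].
  by apply: eq_phase (phase1 k) => m; rewrite addn0 divff.
rewrite exprS; apply: eq_phase (phaseM (phase_shift h hu) IH) => m.
by rewrite addnS mulrA divfK.
Qed.

Lemma phase_lt i k w u : (i < k)%N -> w != 0 -> phase i w u -> phase k 1 u.
Proof.
move=> + w0; elim: k i u => [|k IH] [|i] u //= ik hu; last exact: IH hu.
by apply: eq_phase (phase1 k) => m; rewrite !hu divff.
Qed.

Lemma phase_prod (I : Type) (r : seq I) k (v : I -> nat -> algC) :
    (forall i, phase k 1 (v i)) -> phase k 1 (fun m => \prod_(i <- r) v i m).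
Proof.
move=> hv; elim: r => [|i r IH].
  by apply: eq_phase (phase1 k) => m; rewrite big_nil.
have := phaseM (hv i) IH; rewrite mulr1; apply: eq_phase => m.
by rewrite big_cons.
Qed.

(** Factors of lower degree leave the top of a phase unchanged. The monomial
    phases appear as a hypothesis because this lemma is also the inductive step
    of [phase_monomial]. *)
Lemma phase_prod_top k (z : nat -> algC) :
    (forall i, z i != 0) ->
    (forall i, (i <= k)%N -> phase i (z i ^+ i`!) (fun m => z i ^+ (m ^ i))) ->
  phase k (z k ^+ k`!) (fun m => \prod_(i < k.+1) z i ^+ (m ^ i)).
Proof.
move=> z0 hz; have low : phase k 1 (fun m => \prod_(i < k) z i ^+ (m ^ i)).
  apply: phase_prod => i; apply: (phase_lt (ltn_ord i) _ (hz i _)).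
    by rewrite expf_neq0.
  exact: ltnW.
rewrite -[_ ^+ _]mul1r; apply: eq_phase (phaseM low (hz _ (leqnn k))) => m.
by rewrite big_ord_recr.
Qed.

Lemma phase_monomial k (z : algC) :
  z != 0 -> phase k (z ^+ k`!) (fun m => z ^+ (m ^ k)).
Proof.
elim/ltn_ind: k z => [[|k]] IH z z0 /=; first by move=> m; rewrite expn0.
(* (m + 1)^(k + 1) - m^(k + 1) is the sum of the 'C(k.+1, i) m^i over i <= k *)
pose y i : algC := z ^+ 'C(k.+1, i).
have y0 i : y i != 0 by rewrite expf_neq0.
have -> : z ^+ (k.+1)`! = y k ^+ k`! by rewrite /y binSn -exprM.
apply: eq_phase (phase_prod_top y0 _) => [m|i ik]; last exact: IH.
apply: (canRL (mulfK _)); first by rewrite expf_neq0.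
under eq_bigr do rewrite -exprM.
rewrite prodrXr -exprD; congr (_ ^+ _).
rewrite -[m.+1]add1n expnDn [RHS]big_ord_recr /= binn subnn expn0 !mul1n.
by congr (_ + _)%N; apply: eq_bigr => i _; rewrite exp1n mul1n.
Qed.

Lemma phase_poly k (z : nat -> algC) : (forall i, z i != 0) ->
  phase k (z k ^+ k`!) (fun m => \prod_(i < k.+1) z i ^+ (m ^ i)).
Proof. by move=> z0; apply: phase_prod_top => // i _; apply: phase_monomial. Qed.

Lemma invr_unit_conj x : modulus x = 1 -> x^-1 = x^*.
Proof. by move=> /modulus_eq1P/eqP h; rewrite invC_norm h expr1n invr1 mul1r. Qed.

Lemma modulusV1 x : modulus x = 1 -> modulus x^-1 = 1.
Proof. by move=> h; rewrite invr_unit_conj // modulus_conj. Qed.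

Lemma modulus1_neq0 x : modulus x = 1 -> x != 0.
Proof.
by move=> h; apply/eqP => x0; move: h; rewrite x0 modulus0 => /eqP; rewrite eq_sym oner_eq0.
Qed.

Lemma modulus_sum_shift (u : nat -> algC) L h : (forall m, modulus (u m) = 1) ->
  modulus (\sum_(m < L) u m - \sum_(m < L) u (m + h)%N) <= (2 * h)%:R.
Proof.
move=> u1; elim: h => [|h IH].
  by under [X in _ - X]eq_bigr do rewrite addn0; rewrite subrr modulus0.
have hs : \sum_(m < L) u (m + h)%N - \sum_(m < L) u (m + h.+1)%N =
    u h - u (L + h)%N.
  elim: L {IH} => [|L IH]; first by rewrite !big_ord0 add0n !subrr.
  by rewrite 2!big_ord_recr /= opprD addrACA IH addnS addSn; ring.
rewrite -(subrKA (\sum_(m < L) u (m + h)%N)) hs.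
apply: le_trans (modulusD _ _) _.
have := modulusD (u h) (- u (L + h)%N); rewrite modulusN !u1.
rewrite mulnS natrD; lra.
Qed.

Section VanDerCorput.
Variables (u : nat -> algC) (u1 : forall m, modulus (u m) = 1).

Lemma corr_norm L h h' : (h' <= h)%N ->
  modulus (\sum_(m < L) u (m + h)%N * (u (m + h')%N)^*) <=
  modulus (\sum_(m < L) u (m + (h - h'))%N / u m) + (2 * h')%:R.
Proof.
move=> hh'; pose g m := u (m + (h - h'))%N / u m.
have g1 m : modulus (g m) = 1 by rewrite modulusM modulusV1 ?u1 ?mulr1.
have -> : \sum_(m < L) u (m + h)%N * (u (m + h')%N)^* = \sum_(m < L) g (m + h')%N.
  by apply: eq_bigr => m _; rewrite /g -addnA subnKC // invr_unit_conj.
rewrite -[X in modulus X](subrK (\sum_(m < L) g m)) addrC.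
apply: le_trans (modulusD _ _) _.
by rewrite lerD2l modulusB; exact: modulus_sum_shift.
Qed.

(** Averaging over a window of [H] shifts replaces the sum [S] of the [u m] by
    the sum of the local sums [D m], up to boundary terms. The square of the
    modulus of [D m] expands into correlations of [u] with its shifts. If all
    these were below [L / H], they would add up to no more than the [H] diagonal
    terms, and [S] would be at most of order [L] over the square root of [H];
    the factor 8 in [H = 8 K ^ 2] makes this smaller than [L / K]. *)
Lemma van_der_corput (K L : nat) : (0 < K)%N -> (2 * (8 * K ^ 2) ^ 2 <= L)%N ->
    L%:R <= K%:R * modulus (\sum_(m < L) u m) ->
  exists2 h, (0 < h < 8 * K ^ 2)%N &
    L%:R <= (8 * K ^ 2)%:R * modulus (\sum_(m < L) u (m + h)%N / u m).
Proof.
move=> K0 KL big; set H := (8 * K ^ 2)%N in KL *.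
have H0 : (0 < H)%N by rewrite muln_gt0 expn_gt0 K0.
have [/existsP[h /andP[h0 hh]]|/existsPn none] := boolP [exists h : 'I_H,
    (0 < h)%N && (L%:R <= H%:R * modulus (\sum_(m < L) u (m + h)%N / u m))].
  by exists h => //; rewrite h0 /=.
exfalso.
have small h : (0 < h < H)%N ->
    modulus (\sum_(m < L) u (m + h)%N / u m) < L%:R / H%:R.
  move=> /andP[h0 hH]; have := none (Ordinal hH); rewrite /= h0 /= -ltNge.
  by rewrite ltr_pdivlMr ?ltr0n // mulrC.
pose D (m : nat) := \sum_(h < H) u (m + h)%N.
pose S := \sum_(m < L) u m.
have step1 : H%:R * modulus S <= \sum_(m < L) modulus (D m) + (2 * H ^ 2)%:R.
  have -> : H%:R * modulus S = modulus (\sum_(m < L) D m +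
      \sum_(h < H) (S - \sum_(m < L) u (m + h)%N)).
    rewrite [X in X + _]exchange_big /= sumrB addrC subrK.
    by rewrite sumr_const card_ord -[S *+ H]mulr_natl modulusM modulus_nat.
  apply: le_trans (modulusD _ _) _; apply: lerD; first exact: modulus_sum.
  apply: le_trans (modulus_sum _ _ _) _.
  apply: (@le_trans _ _ (\sum_(h < H) (2 * H)%:R)); last first.
    by rewrite sumr_const card_ord -mulrnA ler_nat; lia.
  apply: ler_sum => h _; apply: le_trans (modulus_sum_shift _ _ u1) _.
  by rewrite ler_nat leq_mul // ltnW.
have step2 : \sum_(m < L) modulus (D m) ^+ 2 <=
    H%:R * L%:R + H%:R ^+ 2 * (L%:R / H%:R + 2 * H%:R).
  have -> : \sum_(m < L) modulus (D m) ^+ 2 = modulus (\sum_(h < H)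
      \sum_(h' < H) \sum_(m < L) u (m + h)%N * (u (m + h')%N)^*).
    have X0 : 0 <= \sum_(m < L) modulus (D m) ^+ 2.
      by apply: sumr_ge0 => m _; rewrite exprn_ge0 ?modulus_ge0.
    have -> : \sum_(h < H) \sum_(h' < H) \sum_(m < L) u (m + h)%N * (u (m + h')%N)^*
       = algRval (\sum_(m < L) modulus (D m) ^+ 2).
      under eq_bigr do rewrite exchange_big.
      rewrite exchange_big algRval_sum; apply: eq_bigr => m _.
      rewrite sqr_modulus rmorph_sum mulr_suml; apply: eq_bigr => h _.
      by rewrite mulr_sumr.
    by apply/val_inj; rewrite /= ger0_norm.
  apply: le_trans (modulus_sum _ _ _) _.
  apply: (@le_trans _ _ (\sum_(h < H) \sum_(h' < H)
      ((if h' == h then L%:R else 0) + (L%:R / H%:R + 2 * H%:R)))).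
    apply: ler_sum => h _; apply: le_trans (modulus_sum _ _ _) _.
    apply: ler_sum => h' _.
    have LH0 : 0 <= L%:R / H%:R :> algR by rewrite divr_ge0 ?ler0n.
    have ord h1 h2 : (h2 < h1 < H)%N ->
        modulus (\sum_(m < L) u (m + h1)%N * (u (m + h2)%N)^*) <=
        L%:R / H%:R + 2 * H%:R.
      move=> /andP[h21 h1H]; apply: le_trans (corr_norm _ (ltnW h21)) _.
      apply: lerD; first by apply/ltW/small; lia.
      by rewrite -natrM ler_nat; lia.
    case: eqP => [->|/eqP hh']; last first.
      rewrite add0r; case: (ltngtP h h') hh' => [lt|lt|/val_inj->]; last by rewrite eqxx.
        move=> _; rewrite -modulus_conj rmorph_sum /=.
        under eq_bigr do rewrite rmorphM /= conjCK mulrC.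
        by apply: ord; rewrite lt /=.
      by move=> _; apply: ord; rewrite lt /=.
    apply: le_trans (modulus_sum _ _ _) _.
    under eq_bigr do rewrite modulusM modulus_conj !u1 mulr1.
    rewrite sumr_const card_ord; have := ler0n algR H; lra.
  under eq_bigr => h _ do rewrite big_split /= -big_mkcond /= big_pred1_eq
    sumr_const card_ord.
  by rewrite sumr_const card_ord -mulr_natl -[_ *+ H]mulr_natl; lra.
(* AM-GM instead of Cauchy-Schwarz; H / K would be the size of D m on average *)
have step3 : \sum_(m < L) modulus (D m) <=
    ((\sum_(m < L) modulus (D m) ^+ 2) * K%:R / H%:R + L%:R * H%:R / K%:R) / 2.
  have -> : L%:R * H%:R / K%:R = \sum_(m < L) (H%:R / K%:R) :> algR.
    by rewrite sumr_const card_ord -[(_ / _) *+ L]mulr_natl mulrA.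
  rewrite -!mulrA !mulr_suml -big_split /= mulr_suml; apply: ler_sum => m _.
  set x := modulus _; set k : algR := K%:R; set H' : algR := H%:R.
  have k0 : 0 < k by rewrite ltr0n.
  have H'0 : 0 < H' by rewrite ltr0n.
  have : 0 <= (x - H' / k) ^+ 2 * (k / H') by rewrite mulr_ge0 ?sqr_ge0 ?divr_ge0 // ltW.
  have -> : (x - H' / k) ^+ 2 * (k / H') = x ^+ 2 * (k / H') - 2 * x + H' / k.
    by field; rewrite ?gt_eqF.
  lra.
move: KL big step1 step2 step3; rewrite -/S.
set s := modulus S; set A := \sum_(m < L) _; set B := \sum_(m < L) _ ^+ 2.
rewrite -(ler_nat algR) (natrM _ 2 (H ^ 2)) (natrX _ H 2) => KL big s1 s2 s3.
have Hk : H%:R = 8 * K%:R ^+ 2 :> algR by rewrite /H natrM natrX.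
have k1 : 1 <= K%:R :> algR by rewrite ler1n.
move: KL big s1 s2 s3 Hk k1; set k : algR := K%:R; set l : algR := L%:R.
set h : algR := H%:R => KL big s1 s2 s3 Hk k1.
have h0 : 0 < h by rewrite ltr0n.
have s2' : B * k / h <= 3 * l * k.
  rewrite ler_pdivrMr //; have -> : 3 * l * k * h = (3 * l * h) * k by ring.
  apply: ler_wpM2r; first by lra.
  have : h ^+ 2 * (l / h + 2 * h) = h * l + h * (2 * h ^+ 2) by field; rewrite gt_eqF.
  have : h * (2 * h ^+ 2) <= h * l by rewrite ler_pM2l.
  lra.
have e : l * h / k = 8 * (l * k) by rewrite Hk; field; rewrite gt_eqF //; lra.
have : 8 * (l * k) <= h * s.
  rewrite -e -mulrA mulrCA; apply: ler_wpM2l; first exact: ltW.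
  by rewrite ler_pdivrMr ?[s * k]mulrC //; lra.
have : l <= l * k by rewrite ler_peMr // ler0n.
have : 0 < l by nra.
move: s3; rewrite e; lra.
Qed.
End VanDerCorput.

(** * Weyl's alternative *)

(** If an average of phases has modulus at least [1 / K], then after [k] van der
    Corput steps some average of differences has modulus at least
    [1 / vdc_iter k K]; the shifts used on the way are below this number too. *)
Definition vdc_iter k K := iter k (fun K => 8 * K ^ 2)%N K.

Lemma leq_vdc_iter k l K : (k <= l)%N -> (vdc_iter k K <= vdc_iter l K)%N.
Proof.
move=> /subnKC <-; elim: (l - k)%N => [|n IH]; first by rewrite addn0.
by apply: leq_trans IH _; rewrite addnS /=; nia.
Qed.

Lemma modulus_expB1 z n : modulus z = 1 -> modulus (z ^+ n - 1) <= n%:R * modulus (z - 1).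
Proof.
move=> z1; elim: n => [|n IH]; first by rewrite subrr modulus0 mul0r.
have -> : z ^+ n.+1 - 1 = z * (z ^+ n - 1) + (z - 1) by rewrite exprS; ring.
apply: le_trans (modulusD _ _) _; rewrite modulusM z1 mul1r -natr1; lra.
Qed.

Lemma modulus_prodB1 (I : Type) (r : seq I) (Q : pred I) (a : I -> algC) :
  (forall i, Q i -> modulus (a i) = 1) ->
  modulus (\prod_(i <- r | Q i) a i - 1) <= \sum_(i <- r | Q i) modulus (a i - 1).
Proof.
move=> a1; elim/big_rec2: _ => [|i s p Qi IH]; first by rewrite subrr modulus0.
have -> : a i * p - 1 = a i * (p - 1) + (a i - 1) by ring.
by apply: le_trans (modulusD _ _) _; rewrite modulusM a1 // mul1r addrC lerD2l.
Qed.

Lemma modulus_prod1 (I : Type) (r : seq I) (Q : pred I) (a : I -> algC) :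
  (forall i, Q i -> modulus (a i) = 1) -> modulus (\prod_(i <- r | Q i) a i) = 1.
Proof.
move=> a1; elim/big_rec: _ => [|i p Qi IH]; first exact: modulus1.
by rewrite modulusM a1 // IH mulr1.
Qed.

Lemma modulus_exp1 z n : modulus z = 1 -> modulus (z ^+ n) = 1.
Proof. by move=> h; rewrite modulusX h expr1n. Qed.

(** Differencing [k] times turns [u] into a geometric progression, whose ratio
    is [w] to the power of the product of the [k] shifts. A geometric sum can
    be large only if its ratio is close to 1. *)
Lemma weyl k K L w (u : nat -> algC) : (forall m, modulus (u m) = 1) ->
    phase k.+1 w u -> (0 < K)%N -> (2 * vdc_iter k K ^ 2 <= L)%N ->
    L%:R <= K%:R * modulus (\sum_(m < L) u m) ->
  exists2 s, (0 < s <= vdc_iter k K ^ k)%N &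
    L%:R * modulus (w ^+ s - 1) <= (2 * vdc_iter k K)%:R.
Proof.
elim: k K w u => [|k IH] K w u u1 hu K0 KL big.
  exists 1%N => //; rewrite expr1.
  have tel : (w - 1) * (\sum_(m < L) u m) = u L - u 0%N.
    elim: L {KL big} => [|L IHL]; first by rewrite big_ord0 mulr0 subrr.
    rewrite big_ord_recr mulrDr IHL /= -(hu L).
    by field; exact: modulus1_neq0.
  have : modulus (w - 1) * modulus (\sum_(m < L) u m) <= 2.
    rewrite -modulusM tel; apply: le_trans (modulusD _ _) _.
    by rewrite modulusN !u1.
  have := ler_wpM2r (modulus_ge0 (w - 1)) big.
  have := @ler_wpM2l algR K%:R (ler0n _ _) (modulus (w - 1) * modulus (\sum_(m < L) u m)) 2.
  rewrite natrM; move=> h h' /h; lra.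
have K8 : (8 * K ^ 2 <= vdc_iter k (8 * K ^ 2))%N by exact: (@leq_vdc_iter 0).
have viS : vdc_iter k.+1 K = vdc_iter k (8 * K ^ 2) by rewrite /vdc_iter iterSr.
rewrite viS in KL *.
have [|h /andP[h0 hH] hbig] := van_der_corput u1 K0 _ big.
  by apply: leq_trans KL; rewrite leq_mul // leq_exp2r.
have v1 m : modulus (u (m + h)%N / u m) = 1 by rewrite modulusM modulusV1 ?u1 ?mulr1.
have hv := phase_diff h (fun m => modulus1_neq0 (u1 m)) hu.
have [|s /andP[s0 sle] hs] := IH _ _ _ v1 hv _ KL hbig; first by rewrite muln_gt0 expn_gt0 K0.
exists (h * s)%N; last by rewrite exprM.
rewrite muln_gt0 h0 s0 expnS leq_mul //; exact: leq_trans (ltnW hH) K8.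
Qed.

(** [dilation] is the [Q] of the stages. Being a factorial, it is a multiple of
    all the products of [k!] (from the top of a phase) and of the exponent [s]
    of [weyl] that can occur when a stage exceeds [1 / J]; the factor 2 in
    [vdc_loss] pays for discarding the negligible monomials. *)
Definition vdc_loss d J := vdc_iter d (2 * J).
Definition dilation d J := (d`! * vdc_loss d J ^ d)`!.

Lemma vdc_loss_gt0 d J : (0 < J)%N -> (0 < vdc_loss d J)%N.
Proof.
have := leq_vdc_iter (2 * J) (leq0n d); rewrite -/(vdc_loss d J) /=; lia.
Qed.

Section Stages.
Variables (d J : nat) (L b : nat -> nat).
Hypotheses (J0 : (0 < J)%N).

Let Km := vdc_loss d J.
Let Q := dilation d J.

(* [L r] is the length of the stage that has [r] stages after it; a base [z i] is
   negligible when [r] stages remain if it is within [1 / b r] of 1. *)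
Hypothesis bL : forall r, (2 * d * J * L r ^ d <= b r.+1)%N.
Hypothesis bb : forall r, (Q ^ d * b r <= b r.+1)%N.
Hypothesis Lb : forall r, (2 * Km * Q ^ d * b r <= L r)%N.
Hypothesis LK : forall r, (2 * Km ^ 2 <= L r)%N.

(** The base [z i] carries the exponent [i + 1], for lack of a constant term. *)
Definition monomials (z : nat -> algC) m := \prod_(i < d) z i ^+ (m ^ i.+1).
Definition dilate (z : nat -> algC) i := z i ^+ (Q ^ i.+1).

(** Dilating the bases amounts to restricting all later stages to the multiples
    of [Q]: see [monomials_dilate]. *)
Fixpoint stages r z : algR := if r is r'.+1 then
  repart (\sum_(m < L r') monomials z m.+1) / (L r')%:R + stages r' (dilate z) else 0.

Lemma monomials_dilate z m : monomials (dilate z) m = monomials z (Q * m).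
Proof. by apply: eq_bigr => i _; rewrite -exprM expnMn. Qed.

Let Km0 : (0 < Km)%N. Proof. exact: vdc_loss_gt0. Qed.

Let L0 r : (0 < L r)%N.
Proof. by apply: leq_trans (LK r); rewrite muln_gt0 expn_gt0 Km0. Qed.

Let Q0 : (0 < Q)%N. Proof. exact: fact_gt0. Qed.

(** [stages r] is a combination of real parts of [monomials] at positive
    integers of size at most [Q ^ r * M]; a linear relation between the latter
    passes to it. *)
Lemma stages_eq0 (I : finType) (a : I -> algR) (z : I -> nat -> algC) r M :
    (forall r', (r' < r)%N -> (L r' <= M)%N) ->
    (forall m, (0 < m <= Q ^ r * M)%N -> \sum_i a i * repart (monomials (z i) m) = 0) ->
  \sum_i a i * stages r (z i) = 0.
Proof.
elim: r z => [|r IH] z LM hz /=; first by rewrite big1 // => i _; rewrite mulr0.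
under eq_bigr do rewrite mulrDr.
rewrite big_split /= IH ?addr0; last 2 first.
- by move=> r' hr'; apply: LM; apply: ltnW.
- move=> m /andP[m0 mM]; under eq_bigr do rewrite monomials_dilate.
  by apply: hz; rewrite muln_gt0 Q0 m0 /= expnS -mulnA leq_mul2l mM orbT.
under eq_bigr do rewrite mulrA repart_sum mulr_sumr.
rewrite -mulr_suml exchange_big big1 ?mul0r // => m _; apply: hz => /=.
apply: leq_trans (ltn_ord m) (leq_trans (LM r _) _) => //.
by rewrite leq_pmull // expn_gt0 Q0.
Qed.

(** Induction on the number of remaining stages, with [k] an upper bound for the
    degree that is still visible. A stage above [-1 / J] leaves [k] as it is.
    Otherwise its modulus exceeds [1 / J], and Weyl's alternative makes the base
    of index [k - 1] negligible from the next stage on. *)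
Lemma stages_ge r k z : (k <= d)%N -> (forall i, modulus (z i) = 1) ->
    (forall i, (k <= i < d)%N -> modulus (z i - 1) * (b r)%:R <= 1) ->
  - (r%:R / J%:R) - k%:R <= stages r z.
Proof.
elim: r k z => [|r IH] k z kd z1 hz /=.
  by rewrite mul0r oppr0 sub0r oppr_le0 ler0n.
have Jgt0 : 0 < J%:R :> algR by rewrite ltr0n.
have Lgt0 : 0 < (L r)%:R :> algR by rewrite ltr0n.
have dz1 i : modulus (dilate z i) = 1 by exact: modulus_exp1.
have QX i : (i < d)%N -> (Q ^ i.+1 <= Q ^ d)%N by move=> id; rewrite leq_pexp2l.
have hdz i : (k <= i < d)%N -> modulus (dilate z i - 1) * (b r)%:R <= 1.
  move=> /andP[ki id]; apply: le_trans (hz i _); last by rewrite ki.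
  apply: le_trans (ler_wpM2r (ler0n _ _) (modulus_expB1 _ (z1 i))) _.
  rewrite mulrAC [X in _ <= X]mulrC ler_wpM2r ?modulus_ge0 // -natrM ler_nat.
  by apply: leq_trans (bb r); rewrite leq_mul2r QX // orbT.
set S := \sum_(m < L r) _.
have := IH k (dilate z) kd dz1 hdz.
rewrite -[r.+1%:R]natr1 mulrDl.
have [ge|lt] := leP (- (1 / J%:R)) (repart S / (L r)%:R); first by lra.
move=> _.
have mono1 m : modulus (monomials z m) = 1.
  by apply: modulus_prod1 => i _; apply: modulus_exp1.
(* the negligible monomials change each term by at most 1 / (2 J) *)
pose u m := \prod_(i < d | (i < k)%N) z i ^+ (m.+1 ^ i.+1).
have u1 m : modulus (u m) = 1 by apply: modulus_prod1 => i _; apply: modulus_exp1.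
have trunc (m : 'I_(L r)) : modulus (monomials z m.+1 - u m) <= 1 / (2 * J%:R).
  have -> : monomials z m.+1 - u m = u m *
      (\prod_(i < d | ~~ (i < k)%N) z i ^+ (m.+1 ^ i.+1) - 1).
    by rewrite /monomials (bigID (fun i : 'I_d => (i < k)%N)) /= -/(u m); ring.
  rewrite modulusM u1 mul1r.
  apply: le_trans (modulus_prodB1 _ _) _ => [i _|]; first exact: modulus_exp1.
  apply: (@le_trans _ _ (\sum_(i < d | ~~ (i < k)%N) (1 / (2 * d%:R * J%:R)))).
    apply: ler_sum => i; rewrite -leqNgt => ki.
    have d1 : (0 < d)%N by apply: leq_ltn_trans (ltn_ord i).
    apply: le_trans (modulus_expB1 _ (z1 i)) _.
    rewrite ler_pdivlMr ?mulr_gt0 ?ltr0n //.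
    apply: le_trans (hz i _); last by rewrite ki /=.
    rewrite mulrAC [X in _ <= X]mulrC; apply: ler_wpM2r; first exact: modulus_ge0.
    rewrite -!natrM ler_nat; apply: leq_trans (bL r).
    rewrite mulnC leq_mul2l; apply/orP; right.
    apply: (@leq_trans (L r ^ i.+1)); first by rewrite leq_exp2r.
    by rewrite leq_pexp2l.
  rewrite sumr_const; set c := #|_|.
  have cd : (c <= d)%N by rewrite -[leqRHS]card_ord max_card.
  have [d00|d1] := posnP d.
    by have -> : c = 0%N; [lia | rewrite mulr0n divr_ge0 ?mulr_ge0].
  have d1' : 0 < d%:R :> algR by rewrite ltr0n.
  have -> : 1 / (2 * J%:R) = (1 / (2 * d%:R * J%:R)) *+ d :> algR.
    by rewrite -[RHS]mulr_natr; field; rewrite ?gt_eqF.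
  by rewrite -[leLHS]mulr_natr -[leRHS]mulr_natr ler_wpM2l ?ler_nat.
have truncS : modulus (S - \sum_(m < L r) u m) <= (L r)%:R / (2 * J%:R).
  rewrite -sumrB; apply: le_trans (modulus_sum _ _ _) _.
  apply: le_trans (ler_sum _ (fun m _ => trunc m)) _.
  by rewrite sumr_const card_ord -[_ *+ L r]mulr_natr; lra.
have SJ : (L r)%:R / J%:R < modulus S.
  have := ler_modulus_repart S; move: lt; rewrite ltr_pdivrMr //; lra.
have big : (L r)%:R <= (2 * J)%:R * modulus (\sum_(m < L r) u m).
  have := modulusD (S - \sum_(m < L r) u m) (\sum_(m < L r) u m); rewrite subrK => h.
  have e : (L r)%:R / J%:R = 2 * ((L r)%:R / (2 * J%:R)) :> algR by field; rewrite gt_eqF.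
  have : (L r)%:R / (2 * J%:R) <= modulus (\sum_(m < L r) u m) by lra.
  by rewrite ler_pdivrMr ?mulr_gt0 // natrM mulrC.
case: k kd hz hdz @u u1 trunc truncS big => [|k] kd hz hdz u u1 trunc truncS big.
  (* no monomial is visible: the average is close to 1, not below -1 / J *)
  exfalso.
  have uE : \sum_(m < L r) u m = (L r)%:R.
    by under eq_bigr do rewrite /u big_pred0_eq; rewrite sumr_const card_ord.
  have := ler_modulus_repart (S - (L r)%:R); rewrite -uE.
  have -> : repart (S - \sum_(m < L r) u m) = repart S - (L r)%:R.
    by rewrite repartD uE; congr (_ + _); apply/val_inj; rewrite /= raddfN /=
      (Creal_ReP _ (realn _ _)) -algRval_natr.
  move: lt; rewrite ltr_pdivrMr // => lt h.
  have : (L r)%:R / (2 * J%:R) <= (L r)%:R / 2 :> algR.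
    rewrite ler_pdivrMr ?mulr_gt0 //.
    have : 1 <= J%:R :> algR by rewrite ler1n.
    nra.
  have : 0 < 1 / J%:R * (L r)%:R :> algR by rewrite mulr_gt0 ?divr_gt0.
  lra.
have kK : (vdc_iter k (2 * J) <= Km)%N by apply: leq_vdc_iter; apply: ltnW.
(* phases are indexed by the true exponents, hence a dummy base for exponent 0 *)
pose y i := if i is i'.+1 then z i' else 1.
have y1 i : modulus (y i) = 1 by case: i => //=; exact: modulus1.
have hu : phase k.+1 (z k ^+ (k.+1)`!) u.
  apply: eq_phase (phase_shift 1 (phase_poly k.+1 (fun i => modulus1_neq0 (y1 i)))) => m.
  rewrite big_ord_recl expr1n mul1r addn1 /u.
  by rewrite (big_ord_widen d (fun i => z i ^+ (m.+1 ^ i.+1)) kd).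
have K0 : (0 < 2 * J)%N by lia.
have KL : (2 * vdc_iter k (2 * J) ^ 2 <= L r)%N.
  by apply: leq_trans (LK r); rewrite leq_mul2l leq_exp2r.
have [s /andP[s0 sle] hs] := weyl u1 hu K0 KL big.
have sdvd : ((k.+1)`! * s %| Q)%N.
  apply: dvdn_fact; rewrite muln_gt0 fact_gt0 s0 /=; apply: leq_mul.
    exact: leq_fact.
  apply: leq_trans sle (leq_trans (_ : _ <= Km ^ k)%N _).
    by case: (k) kK => // k' kK; rewrite leq_exp2r.
  by rewrite leq_pexp2l // ltnW.
have [q qE] := dvdnP (dvdn_trans sdvd (dvdn_exp (ltn0Sn k) (dvdnn Q))).
have qQ : (q <= Q ^ d)%N.
  apply: leq_trans (QX k kd); rewrite qE leq_pmulr // muln_gt0 fact_gt0 //.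
have hdk : modulus (dilate z k - 1) * (b r)%:R <= 1.
  have : modulus (dilate z k - 1) <= q%:R * modulus ((z k ^+ (k.+1)`!) ^+ s - 1).
    rewrite /dilate qE mulnC exprM; apply: le_trans (modulus_expB1 _ _) _.
      exact: modulus_exp1.
    by rewrite exprM.
  set e := modulus (_ ^+ s - 1) in hs *; set f := modulus (dilate z k - 1) => fe.
  rewrite -(ler_pM2l Lgt0) mulr1.
  have e0 : 0 <= e by exact: modulus_ge0.
  have h1 : (L r)%:R * f <= (Q ^ d * (2 * Km))%:R.
    apply: (@le_trans _ _ ((L r)%:R * ((Q ^ d)%:R * e))).
      apply: ler_wpM2l; first exact: ltW.
      by apply: le_trans fe _; rewrite ler_wpM2r // ler_nat.
    rewrite mulrCA natrM ler_wpM2l ?ler0n //; apply: le_trans hs _.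
    by rewrite ler_nat leq_mul2l kK orbT.
  rewrite mulrA; apply: le_trans (ler_wpM2r (ler0n _ (b r)) h1) _.
  rewrite -natrM ler_nat; apply: leq_trans (Lb r).
  by rewrite [(Q ^ d * _)%N]mulnC.
have hdk' i : (k <= i < d)%N -> modulus (dilate z i - 1) * (b r)%:R <= 1.
  by rewrite leq_eqVlt => /andP[/orP[/eqP<-//|ki] id]; apply: hdz; rewrite ki.
have := IH k (dilate z) (ltnW kd) dz1 hdk'.
have : - 1 <= repart S / (L r)%:R.
  rewrite ler_pdivlMr // mulN1r; apply: le_trans (ler_modulus_repart S).
  rewrite lerN2; apply: le_trans (modulus_sum _ _ _) _.
  by under eq_bigr do rewrite mono1; rewrite sumr_const card_ord.
have : 0 <= 1 / J%:R :> algR by rewrite divr_ge0.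
rewrite -[k.+1%:R]natr1; lra.
Qed.
End Stages.

(** * Doubly exponential growth *)

Section Growth.
Implicit Types f g : nat -> nat.

Definition single_exp f := exists c, forall J, (0 < J)%N -> (f J <= 2 ^ (c * J))%N.
Definition double_exp f := exists c, forall J, (0 < J)%N -> (f J <= 2 ^ (2 ^ (c * J)))%N.

Lemma leq_pow2 n : (n <= 2 ^ n)%N. Proof. exact/ltnW/ltn_expl. Qed.

Lemma single_exp_cst a : single_exp (fun=> a).
Proof.
by exists a => J J0; apply: leq_trans (leq_pow2 a) _; rewrite leq_exp2l // leq_pmulr.
Qed.

Lemma single_exp_id : single_exp id.
Proof. by exists 1%N => J _; rewrite mul1n leq_pow2. Qed.

Lemma single_expM f g : single_exp f -> single_exp g -> single_exp (fun J => f J * g J)%N.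
Proof.
move=> [c hc] [c' hc']; exists (c + c')%N => J J0.
by rewrite mulnDl expnD leq_mul ?hc ?hc'.
Qed.

Lemma leq_expn2r m n e : (m <= n)%N -> (m ^ e <= n ^ e)%N.
Proof. by case: e => // e mn; rewrite leq_exp2r. Qed.

Lemma single_expX f n : single_exp f -> single_exp (fun J => f J ^ n)%N.
Proof.
move=> [c hc]; exists (c * n)%N => J J0.
by rewrite mulnAC expnM leq_expn2r ?hc.
Qed.

Lemma single_exp_pow a : single_exp (expn a).
Proof.
by exists a => J J0; rewrite expnM leq_expn2r // leq_pow2.
Qed.

Lemma double_exp_single f : single_exp f -> double_exp f.
Proof.
move=> [c hc]; exists c => J J0; apply: leq_trans (hc J J0) _.
by rewrite leq_exp2l // leq_pow2.
Qed.

Lemma double_expM f g : double_exp f -> double_exp g -> double_exp (fun J => f J * g J)%N.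
Proof.
move=> [c hc] [c' hc']; exists (c + c').+1 => J J0.
apply: leq_trans (leq_mul (hc J J0) (hc' J J0)) _.
rewrite -expnD leq_exp2l //.
have h1 : (2 ^ (c * J) <= 2 ^ ((c + c') * J))%N by rewrite leq_exp2l // leq_mul2r leq_addr orbT.
have h2 : (2 ^ (c' * J) <= 2 ^ ((c + c') * J))%N by rewrite leq_exp2l // leq_mul2r leq_addl orbT.
have h3 : (2 ^ ((c + c') * J).+1 <= 2 ^ ((c + c').+1 * J))%N by rewrite leq_exp2l //; lia.
by apply: leq_trans h3; rewrite expnS; lia.
Qed.

Lemma double_expX f g : double_exp f -> single_exp g -> double_exp (fun J => f J ^ g J)%N.
Proof.
move=> [c hc] [c' hc']; exists (c + c')%N => J J0.
apply: leq_trans (leq_expn2r _ (hc J J0)) _.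
by rewrite -expnM leq_exp2l // mulnDl expnD leq_mul2l hc' ?orbT.
Qed.

Lemma fact_leq_expn n : (n`! <= n ^ n)%N.
Proof.
rewrite fact_prod big_add1 /= big_mkord.
have -> : (n ^ n = \prod_(i < n) n)%N by rewrite prod_nat_const card_ord.
by apply: leq_prod => i _.
Qed.

Lemma double_exp_fact f : single_exp f -> double_exp (fun J => (f J)`!).
Proof.
move=> hf; have [c hc] := double_expX (double_exp_single hf) hf.
by exists c => J J0; apply: leq_trans (fact_leq_expn _) (hc J J0).
Qed.

Lemma single_exp_vdc_iter k : single_exp (fun J => vdc_iter k (2 * J)).
Proof.
elim: k => [|k IH]; first exact: single_expM (single_exp_cst 2) single_exp_id.
exact: single_expM (single_exp_cst 8) (single_expX 2 IH).
Qed.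

End Growth.

Section Sizes.
Variables (d : nat).
(** [base J] dominates all the constants in the conditions on stages; with
    [b r] the power of exponent [(2 d + 2) ^ r] of [base J], the stage lengths
    are [L r = base J * b r], and [b r.+1] exceeds [base J * L r ^ d]. *)
Definition base J := (2 * d.+1 * J * vdc_loss d J ^ 2 * dilation d J ^ d)%N.
Definition stage_length J r := (base J ^ ((2 * d + 2) ^ r).+1)%N.
Definition recurrence_bound J :=
  (dilation d J ^ J * base J ^ ((2 * d + 2) ^ J * 2))%N.

Lemma double_exp_recurrence_bound : double_exp recurrence_bound.
Proof.
have hK := single_exp_vdc_iter d.
have hQ : double_exp (dilation d).
  exact/double_exp_fact/(single_expM (single_exp_cst _))/single_expX.
have hX : double_exp base.
  apply: double_expM (double_expX hQ (single_exp_cst d)).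
  apply: double_exp_single; apply: single_expM (single_expX 2 hK).
  exact: single_expM (single_exp_cst _) single_exp_id.
apply: double_expM (double_expX hQ single_exp_id) (double_expX hX _).
exact: single_expM (single_exp_pow _) (single_exp_cst 2).
Qed.
End Sizes.

(** * Recurrence in finite abelian groups *)

Section Fourier.
Variables (gT : finGroupType) (abG : abelian [set: gT]) (S : {set gT}).
Let G := [set: gT]%G.

Definition fourier (i : Iirr G) : algC := \sum_(x in S) 'chi_i x.

Let lin i : 'chi[G]_i \is a linear_char.
Proof. by move/char_abelianP: (abG). Qed.

Let class_ab (x y : gT) : (x \in (y ^: G)%g) = (x == y).
Proof.
apply/imsetP/eqP => [[g _ ->]|->]; last by exists 1%g; rewrite ?inE ?conjg1.
by rewrite conjgE (centsP abG y _ g _) ?inE // mulKg.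
Qed.

Let cent_ab (x : gT) : #|('C_G[x])%g| = #|gT|.
Proof.
rewrite -cardsT; congr #|pred_of_set _|; apply/setP => y; rewrite finset.in_setI !finset.in_setT /=.
by apply/cent1P; apply: (centsP abG); rewrite finset.in_setT.
Qed.

Lemma sum_char_conj (w y : gT) :
  \sum_i 'chi[G]_i w * ('chi_i y)^* = if w == y then #|gT|%:R else 0.
Proof.
rewrite second_orthogonality_relation ?inE // class_ab cent_ab.
by case: eqP => _; rewrite ?mulr1n ?mulr0n.
Qed.

(** The squared Fourier coefficients of [S] are the spectral measure of the
    correlations of [S] with its translates. *)
Lemma fourier_corr (v : gT) :
  \sum_i modulus (fourier i) ^+ 2 * repart ('chi_i v) =
  (#|gT| * #|[set x in S | (x * v)%g \in S]|)%:R.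
Proof.
under eq_bigr do rewrite -repartMl.
rewrite -repart_sum -repart_nat; congr repart.
have expand i : algRval (modulus (fourier i) ^+ 2) * 'chi_i v =
    \sum_(x in S) \sum_(y in S) 'chi_i (x * v)%g * ('chi_i y)^*.
  rewrite sqr_modulus mulrAC mulr_suml mulr_suml; apply: eq_bigr => x _.
  rewrite lin_charM ?inE // rmorph_sum mulr_sumr.
  by apply: eq_bigr => y _.
under eq_bigr do rewrite expand.
rewrite exchange_big natrM -sum1_card natr_sum mulr_sumr.
under [RHS]eq_bigl do rewrite inE.
rewrite [RHS]big_mkcondr; apply: eq_bigr => x xS /=.
rewrite exchange_big /=; under eq_bigr do rewrite sum_char_conj.
rewrite -big_mkcondr /= mulr1.
case: ifP => xvS; last first.
  by rewrite big1 // => y /andP[yS /eqP xvy]; rewrite xvy yS in xvS.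
rewrite (big_pred1 (x * v)%g) // => y /=; rewrite [RHS]eq_sym.
by case: eqP => [<-|]; rewrite ?xvS ?andbF.
Qed.

End Fourier.

Lemma stages_one d J L r z : (forall r, 0 < L r)%N -> (forall i, z i = 1) ->
  stages d J L r z = r%:R.
Proof.
move=> L0; elim: r z => [//|r IH] z z1 /=.
rewrite IH => [|i]; last by rewrite /dilate z1 expr1n.
have mono1 m : monomials d z m = 1 by rewrite /monomials big1 // => i _; rewrite z1 expr1n.
under eq_bigr do rewrite mono1.
rewrite sumr_const card_ord repart_nat divff ?pnatr_eq0 -?lt0n //.
by rewrite -[RHS]natr1 addrC.
Qed.

(** Sum over all characters of [stages] at the values of the character on the
    [e i], with the squared Fourier coefficients of [S] as weights: the sum
    vanishes if there is no recurrence up to [recurrence_bound d J], while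
    [stages_ge] and the trivial character bound it below. *)
Lemma polynomial_recurrence d J (gT : finGroupType) (S : {set gT}) (e : nat -> gT) :
    abelian [set: gT] -> (0 < J)%N -> (d.+1 * #|gT| < J * #|S|)%N ->
  exists2 m, (0 < m <= recurrence_bound d J)%N &
    exists2 x, x \in S & (x * \prod_(i < d) e i ^+ (m ^ i.+1))%g \in S.
Proof.
move=> abG J0 dens; pose B := recurrence_bound d J.
pose gam m : gT := (\prod_(i < d) e i ^+ (m ^ i.+1))%g.
have [/existsP[m /andP[m0 /exists_inP[x xS xmS]]]|/existsPn none] :=
    boolP [exists m : 'I_B.+1, (0 < m)%N && [exists x in S, (x * gam m)%g \in S]].
  by exists (m : nat); [rewrite m0; apply: (ltn_ord m) | exists x].
exfalso.
have {}none m : (0 < m <= B)%N -> #|[set x in S | (x * gam m)%g \in S]| = 0%N.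
  move=> /andP[m0 mB]; have := none (Ordinal (mB : (m < B.+1)%N)); rewrite /= m0 /=.
  move=> /exists_inPn h; apply/eqP; rewrite cards_eq0 -finset.subset0; apply/fintype.subsetP => x.
  by rewrite inE => /andP[xS]; rewrite (negPf (h x xS)).
pose G := [set: gT]%G; pose z (i : Iirr G) (k : nat) : algC := 'chi_i (e k).
have lin (i : Iirr G) : 'chi_i \is a linear_char by move/char_abelianP: abG.
have zE i m : monomials d (z i) m = 'chi_i (gam m).
  rewrite lin_char_prod ?inE // => [|k _]; last by rewrite inE.
  by apply: eq_bigr => k _; rewrite lin_charX ?inE.
pose a i := modulus (fourier S i) ^+ 2.
pose L := stage_length d J.
have X0 : (0 < base d J)%N.
  by rewrite !muln_gt0 !expn_gt0 fact_gt0 J0 vdc_loss_gt0.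
have L0 r : (0 < L r)%N by rewrite expn_gt0 X0.
have a0 i : 0 <= a i by rewrite exprn_ge0 ?modulus_ge0.
have main : \sum_i a i * stages d J L J (z i) = 0.
  pose Lmax := (base d J ^ ((2 * d + 2) ^ J * 2))%N.
  apply: (stages_eq0 (M := Lmax)) => [r rJ|m /none hm].
    rewrite leq_pexp2l // muln2 -addnn -[X in (X < _)%N]addn0 -addnS leq_add //.
      by rewrite leq_pexp2l ?(ltnW rJ) // addn2.
    by rewrite expn_gt0 addn2.
  under eq_bigr do rewrite zE.
  by rewrite fourier_corr // hm muln0.
have lower i : - d.+1%:R <= stages d J L J (z i).
  pose b r := (base d J ^ ((2 * d + 2) ^ r))%N.
  have LE r : L r = (base d J * b r)%N by rewrite /L /stage_length expnS.
  have K0 := vdc_loss_gt0 d J0.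
  have Q0 : (0 < dilation d J)%N by exact: fact_gt0.
  have Qd0 : (0 < dilation d J ^ d)%N by rewrite expn_gt0 Q0.
  have K20 : (0 < vdc_loss d J ^ 2)%N by rewrite expn_gt0 K0.
  have b0 r : (0 < b r)%N by rewrite expn_gt0 X0.
  have bS r : (base d J * L r ^ d <= b r.+1)%N.
    rewrite /L /stage_length /b -expnM -expnS leq_pexp2l // expnS.
    have : (0 < (2 * d + 2) ^ r)%N by rewrite expn_gt0 addn2.
    by move: ((2 * d + 2) ^ r)%N => n; nia.
  have bS' r : (L r <= b r.+1)%N.
    rewrite leq_pexp2l // expnS.
    have : (0 < (2 * d + 2) ^ r)%N by rewrite expn_gt0 addn2.
    by move: ((2 * d + 2) ^ r)%N => n; nia.
  have XE : (base d J = 2 * d.+1 * J * vdc_loss d J ^ 2 * dilation d J ^ d)%N by [].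
  have := @stages_ge d J L b J0 _ _ _ _ J d (z i) (leqnn d) _ _.
  rewrite divff ?pnatr_eq0 -?lt0n // -[d.+1%:R]natr1 => h.
  rewrite opprD addrC; apply: h => [r|r|r|r|k|k].
  - apply: leq_trans (bS r); rewrite leq_mul2r XE; apply/orP; right.
    apply: leq_trans (leq_pmulr _ Qd0); apply: leq_trans (leq_pmulr _ K20).
    by rewrite leq_mul2r leq_mul2l leqnSn !orbT.
  - apply: leq_trans (bS' r); rewrite LE leq_mul2r XE; apply/orP; right.
    by rewrite leq_pmull // !muln_gt0 J0 K0.
  - rewrite LE leq_mul2r XE; apply/orP; right.
    rewrite leq_mul2r; apply/orP; right; rewrite -!mulnA leq_mul2l /= mulnA expnS expn1 mulnA.
    by rewrite leq_pmull // !muln_gt0 J0 K0.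
  - rewrite LE XE.
    apply: leq_trans (leq_pmulr _ (b0 r)); apply: leq_trans (leq_pmulr _ Qd0).
    by rewrite leq_mul2r -mulnA leq_pmulr ?orbT ?muln_gt0.
  - by apply/modulus_eq1P/eqP; apply: normC_lin_char; rewrite ?inE.
  - by move=> /andP[dk]; rewrite ltnNge dk.
have a_tot : \sum_i a i = (#|gT| * #|S|)%:R.
  have := fourier_corr abG S 1%g; under eq_bigr do rewrite lin_char1 // repart1 mulr1.
  move=> ->; congr (_ * _)%:R; apply: eq_card => x; rewrite inE mulg1 andbb //.
have a_0 : a 0 = #|S|%:R ^+ 2.
  rewrite /a /fourier irr0; under eq_bigr do rewrite cfun1E inE.
  by rewrite sumr_const modulus_nat.
have st_0 : stages d J L J (z 0) = J%:R.
  by apply: stages_one => // k; rewrite /z irr0 cfun1E inE.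
have : J%:R * #|S|%:R ^+ 2 <= d.+1%:R * (#|gT| * #|S|)%:R :> algR.
  rewrite -a_0 -a_tot.
  move: main; rewrite (bigD1 0) //= st_0 [in X in _ -> X](bigD1 0) //=.
  have : - d.+1%:R * \sum_(i | i != 0) a i <= \sum_(i | i != 0) a i * stages d J L J (z i).
    rewrite mulr_sumr; apply: ler_sum => i _; rewrite mulrC; exact: ler_wpM2l.
  have : 0 <= d.+1%:R * a 0 by rewrite mulr_ge0.
  lra.
have S0 : (0 < #|S|)%N by move: dens; case: #|S| => //; rewrite muln0.
rewrite -natrX -!natrM ler_nat; apply/negP; rewrite -ltnNge.
by rewrite mulnA -mulnn mulnA ltn_pmul2r.
Qed.

Lemma recurrence_bound_gt0 d J : (0 < J)%N -> (0 < recurrence_bound d J)%N.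
Proof.
by move=> J0; rewrite muln_gt0 !expn_gt0 fact_gt0 !muln_gt0 J0 vdc_loss_gt0 // expn_gt0 fact_gt0.
Qed.

(** The box is embedded in the group of tuples modulo [2 M]. A shift by at most
    [M] of a coordinate below [M] does not wrap around, so the relation found
    in the group is one between integers; the density loses a factor [2 ^ d]. *)
Lemma recurrence_in_box d J (M := (recurrence_bound d J ^ d)%N)
    (W : {set {ffun 'I_d -> 'I_M}}) :
    (0 < J)%N -> (d.+1 * (2 * M) ^ d < J * #|W|)%N ->
  exists2 m, (0 < m)%N & exists z z', [/\ z \in W, z' \in W &
    forall k, z' k = (z k + m ^ k.+1)%N :> nat].
Proof.
move=> J0 dens; have M0 : (0 < M)%N by rewrite expn_gt0 recurrence_bound_gt0.
have [q qE] : exists q, (2 * M = q.+2)%N by exists (2 * M - 2)%N; lia.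
pose gT := 'rV['I_q.+2]_d.
pose emb (z : {ffun 'I_d -> 'I_M}) : gT := \row_k inord (z k).
have embE z k : emb z 0 k = z k :> nat.
  by rewrite mxE inordK //; have := ltn_ord (z k); lia.
have emb_inj : injective emb.
  by move=> z z' zz'; apply/ffunP => k; apply/val_inj; rewrite /= -!embE zz'.
pose e k : gT := \row_(j < d) (j == k :> nat)%:R.
have gamE m (j : 'I_d) :
    ((\prod_(k < d) e k ^+ (m ^ k.+1))%g : gT) 0 j = (m ^ j.+1)%:R.
  have -> : (\prod_(k < d) e k ^+ (m ^ k.+1))%g = \sum_(k < d) e k *+ (m ^ k.+1) :> gT by [].
  rewrite summxE (bigD1 j) //= big1 ?addr0 => [|k kj].
    by rewrite mulmxnE mxE eqxx.
  by rewrite mulmxnE mxE (val_eqE j k) eq_sym (negPf kj) mul0rn.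
have [||m /andP[m0 mB] [x /imsetP[z zW ->] /imsetP[z' z'W]]] :=
    @polynomial_recurrence d J gT (emb @: W) e _ J0.
- exact: FinRing.zmod_abelian.
- by rewrite card_mx mul1n card_ord card_imset // -qE.
rewrite FinRing.zmodMgE => h; exists m => //; exists z, z'; split=> // k.
have := congr1 (fun A : gT => A 0 k : nat) h; rewrite !embE => <-.
have mM : (m ^ k.+1 <= M)%N.
  apply: (@leq_trans (recurrence_bound d J ^ k.+1)); first by rewrite leq_exp2r.
  by rewrite leq_pexp2l // recurrence_bound_gt0.
have := ltn_ord (z k); rewrite mxE gamE Zp_nat /= embE => zM.
by rewrite (@modn_small (m ^ _)) ?modn_small //; lia.
Qed.

(** * Translates of a set of positive outer measure *)

Local Open Scope classical_set_scope.
Local Open Scope ring_scope.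

(** Double counting without integrals. Cutting [X] along one of the sets leaves a
    piece on which the remaining multiplicity is at most [k - 1] and a piece on
    which it is still at most [k]; measurability makes the measures add up. *)
Lemma sum_caratheodory_le (R : realType) (T : Type) (mu : set T -> \bar R)
    (I : eqType) (r : seq I) (A : I -> set T) k (X : set T) :
    mu set0 = 0%E -> (forall X, 0 <= mu X)%E ->
    (forall i, mu.-caratheodory (A i)) ->
    (forall x, X x -> (count (fun i => `[< A i x >]) r <= k)%N) ->
  (\sum_(i <- r) mu (X `&` A i) <= (mu X *+ k)%R)%E.
Proof.
move=> mu0 mu_ge0 mA; elim: r k X => [|a r IH] k X count_le.
  by rewrite big_nil; elim: k {count_le} => [//|k IH]; rewrite mulrS adde_ge0.
case: k count_le => [|k] count_le.
  rewrite big1_seq ?mulr0n // => i /= ir.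
  suff -> : X `&` A i = set0 by [].
  rewrite -subset0 => x [/count_le + Aix].
  rewrite leqn0 -[_ == _]negbK -lt0n -has_count => /hasPn/(_ i ir).
  by move=> /negP; apply; apply/asboolP.
have split_a i : mu (X `&` A i) =
    (mu ((X `&` A a) `&` A i) + mu ((X `&` ~` A a) `&` A i))%E.
  by rewrite (mA a (X `&` A i)) -!setIA [A i `&` A a]setIC [A i `&` ~` A a]setIC.
rewrite big_cons; under eq_bigr do rewrite split_a.
rewrite big_split /= (mA a X) mulrnDl mulrS -addeA.
apply: leeD => //; apply: leeD; apply: IH => x [Xx Aax]; have := count_le x Xx => /=.
  by rewrite asboolT // add1n ltnS.
by rewrite asboolF.
Qed.

Section Outer.
Variables (R : realType) (n : nat) (n0 : (0 < n)%N).
Notation mu := (@lebesgue_outer_measure R n).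
Implicit Types (E X : set 'rV[R]_n) (v : 'rV[R]_n).

Lemma box_volume0 : box_volume 0 (0 : 'rV[R]_n) = 0.
Proof.
by case: n n0 => // n' _; rewrite /box_volume big_ord_recl mxE subrr mul0r.
Qed.

Lemma box_volume_ge0 (a b : 'rV[R]_n) : (forall i, a 0 i <= b 0 i) -> 0 <= box_volume a b.
Proof. by move=> ab; apply: prodr_ge0 => i _; rewrite subr_ge0. Qed.

Lemma outer_measure_ge0 E : (0 <= mu E)%E.
Proof.
apply: le_ereal_inf_tmp => _ [B [ab _] <-]; apply: nneseries_ge0 => k _ _.
by rewrite lee_fin box_volume_ge0.
Qed.

Lemma outer_measure_le_box (a b : 'rV[R]_n) E : (forall i, a 0 i <= b 0 i) ->
  E `<=` box a b -> (mu E <= (box_volume a b)%:E)%E.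
Proof.
move=> ab Eab; pose B (k : nat) : 'rV[R]_n * 'rV[R]_n := if k is 0%N then (a, b) else (0, 0).
apply: ge_ereal_inf; eexists; last exact: lexx.
exists B.
  split=> [[|k] i //|x Ex]; by [exists 0%N => //=; apply: Eab].
rewrite (nneseries_split 0 1) => [|k _]; last first.
  by rewrite lee_fin; case: k => [|k]; rewrite ?box_volume0 ?box_volume_ge0.
rewrite add0n big_nat1 eseries0 ?adde0 // => -[|k] _ _ //=.
by rewrite box_volume0.
Qed.

Lemma outer_measure_set0 : mu set0 = 0%E.
Proof.
apply/eqP; rewrite eq_le outer_measure_ge0 andbT.
apply: le_trans (@outer_measure_le_box 0 0 set0 _ _) _ => //.
by rewrite box_volume0.
Qed.

Lemma outer_measure_shift_le E v : (mu [set x | E (x + v)%R] <= mu E)%E.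
Proof.
apply: le_ereal_inf_tmp => _ [B [ab cov] <-].
apply: ge_ereal_inf; eexists; last exact: lexx.
exists (fun k => ((B k).1 - v, (B k).2 - v)).
  split=> [k i|x /cov[k _ hk]]; first by rewrite !mxE lerD2r.
  by exists k => // i; move: (hk i); rewrite !mxE lerBlDr lerBrDr.
apply: eq_eseriesr => k _; congr (_%:E); apply: eq_bigr => i _.
by rewrite !mxE; ring.
Qed.

Lemma outer_measure_shift E v : mu [set x | E (x + v)] = mu E.
Proof.
apply/eqP; rewrite eq_le outer_measure_shift_le /=.
have := outer_measure_shift_le [set x | E (x + v)] (- v).
by under eq_set do rewrite /= subrK.
Qed.

Lemma lebesgue_measurable_shift E v :
  lebesgue_measurable E -> lebesgue_measurable [set x | E (x + v)].
Proof.
move=> mE X; rewrite -(outer_measure_shift X (- v)).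
rewrite (mE [set x | X (x - v)]); congr (_ + _)%E; rewrite -[RHS](outer_measure_shift _ (- v));
  by congr mu; apply/seteqP; split=> x /=; rewrite ?subrK.
Qed.

(** All the translates lie in a cube of side [3 N], so their measures add up to at
    most [k * (3 N) ^ n]. *)
Lemma translates_pigeonhole (I : finType) (v : I -> 'rV[R]_n) (E : set 'rV[R]_n)
    (N eps : R) (k : nat) : 0 < N -> lebesgue_measurable E ->
    E `<=` [set x | forall i, 0 <= x 0 i <= N] ->
    ((eps * N ^+ n)%:E <= mu E)%E ->
    (forall j i, `|v j 0 i| <= N) ->
    (forall x, (#|[pred j | `[< E (x + v j)%R >]]| <= k)%N) ->
  #|I|%:R * eps <= k%:R * 3 ^+ n.
Proof.
move=> N0 mE EN Eeps vN hk.
pose X := box (const_mx (- N)) (const_mx (2 * N)) : set 'rV[R]_n.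
pose A j : set 'rV[R]_n := [set x | E (x + v j)].
have AX j : X `&` A j = A j.
  apply/setIidr => x /EN Ex i; rewrite !mxE.
  by move: (Ex i) (vN j i); rewrite !mxE ler_norml; lra.
have := @sum_caratheodory_le R _ mu I (enum I) A k X outer_measure_set0 outer_measure_ge0.
move=> /(_ (fun j => lebesgue_measurable_shift (v j) mE)) h.
have {}h : (\sum_(j <- enum I) mu (X `&` A j) <= (mu X *+ k)%R)%E.
  apply: h => x _; apply: leq_trans (hk x).
  by rewrite enumT cardE /enum_mem size_filter; apply: sub_count.
have volX : (mu X <= ((3 * N) ^+ n)%:E)%E.
  have -> : (3 * N) ^+ n = box_volume (const_mx (- N)) (const_mx (2 * N) : 'rV[R]_n).
    rewrite /box_volume -[in LHS](card_ord n) -prodr_const; apply: eq_bigr => i _.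
    by rewrite !mxE; ring.
  by apply: outer_measure_le_box => // i; rewrite !mxE; lra.
have natmulE (x : R) m : (x%:E *+ m)%R = (x *+ m)%:E.
  by elim: m => [|m IH]; rewrite ?mulr0n // !mulrS EFinD IH.
have lower : ((#|I|%:R * (eps * N ^+ n))%:E <= \sum_(j <- enum I) mu (X `&` A j))%E.
  under eq_bigr do rewrite AX outer_measure_shift.
  rewrite mulr_natl -natmulE big_enum /=.
  apply: (@le_trans _ _ (\sum_(j in I) (eps * N ^+ n)%:E)%E).
    by rewrite sumr_const.
  by apply: lee_sum.
have upper : ((mu X *+ k)%R <= ((3 * N) ^+ n *+ k)%:E)%E.
  rewrite -natmulE; elim: (k) => [|m IH]; rewrite ?mulr0n // 2!(mulrS _ m).
  exact: leeD.
have := le_trans lower (le_trans h upper).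
rewrite lee_fin -[leRHS]mulr_natl exprMn !mulrA ler_pM2r ?exprn_gt0 //.
Qed.
End Outer.

(** * The polynomial curve *)

(** The argument of [f] will be the number of stages; it is at most a multiple of
    [1 / eps], hence of [eps ^- 4], which absorbs all the constants. *)
Lemma double_exp_real (R : realType) (f : nat -> nat) (a D : R) :
    double_exp f -> 0 <= a -> 0 <= D ->
  exists2 c : R, 0 < c & forall eps : R, 0 < eps < 1 / 2 ->
    expR (- expR (c * eps ^- 4)) * D * (f (Num.truncn (a / eps)).+1)%:R < 1.
Proof.
move=> [b hb] a0 D0; pose c : R := 1 + D + b%:R * (a + 1).
have c0 : 0 < c by rewrite ltr_wpDr ?mulr_ge0 ?addr_ge0 //; lra.
exists c => // eps /andP[e0 e1]; set J := (Num.truncn (a / eps)).+1.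
have i1 : 1 <= eps^-1 by rewrite invf_ge1 //; lra.
have i4 : eps^-1 <= eps ^- 4 by rewrite -exprVn ler_eXnr.
have JR : J%:R <= (a + 1) * eps ^- 4.
  apply: le_trans (ler_wpM2l _ i4); last by lra.
  rewrite -natr1 mulrDl mul1r lerD // truncn_le ?divr_ge0 //; lra.
have fle : (f J)%:R <= expR (expR (b%:R * J%:R)) :> R.
  have two (n : nat) : 2 ^+ n <= expR n%:R :> R.
    rewrite -[n%:R]mulr1 expRM_natl lerXn2r ?nnegrE ?expR_ge0 //.
    exact: le_trans (expR_ge1Dx 1).
  have : (f J)%:R <= (2 ^ (2 ^ (b * J)))%:R :> R by rewrite ler_nat hb.
  rewrite natrX => /le_trans; apply; apply: le_trans (two _) _.
  by rewrite ler_expR natrX -natrM.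
have Dle : D < expR (expR D).
  have := expR_ge1Dx D; have := expR_ge1Dx (expR D); lra.
have mid : expR D + expR (b%:R * J%:R) <= expR (c * eps ^- 4).
  apply: (@le_trans _ _ (expR 1 * expR (D + b%:R * J%:R))).
    have := expR_ge1Dx (1 : R).
    have : expR D <= expR (D + b%:R * J%:R) by rewrite ler_expR lerDl mulr_ge0.
    have : expR (b%:R * J%:R) <= expR (D + b%:R * J%:R) by rewrite ler_expR lerDr.
    have := expR_ge0 (D + b%:R * J%:R); nra.
  rewrite -expRD ler_expR /c addrA mulrDl lerD //; last first.
    by rewrite -mulrA ler_wpM2l.
  rewrite ler_peMr //; first by lra.
  exact: le_trans i4.
rewrite -mulrA expRN -ltr_pdivlMl ?invr_gt0 ?expR_gt0 // invrK mulr1.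
apply: lt_le_trans (_ : _ < expR (expR D + expR (b%:R * J%:R))) _; last by rewrite ler_expR.
rewrite expRD; apply: le_lt_trans (ler_wpM2l D0 fle) _.
by rewrite ltr_pM2r ?expR_gt0.
Qed.

Theorem theorem1p2 (R : realType) (n : nat) (hn : (1 <= n)%N)
  (P : 'I_n -> {poly R})
  (P_neq0 : forall i, P i != 0)
  (P_at0 : forall i, (P i).[0] = 0)
  (P_deg : forall i j : 'I_n, i != j -> degree (P i) != degree (P j)) :
  let gamma := poly_curve P in
  let d := (\max_(i < n) degree (P i))%N in
  exists c : R, 0 < c /\
    forall eps : R, 0 < eps < 1 / 2 ->
    forall N : R, 1 <= N ->
    forall E : set 'rV[R]_n,
      lebesgue_measurable E ->
      E `<=` [set x : 'rV[R]_n | forall i, 0 <= x 0 i <= N] ->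
      ((eps * N ^+ n)%:E <= lebesgue_outer_measure E)%E ->
      let delta := expR (- expR (c * eps ^- 4)) in
      exists (x : 'rV[R]_n) (t : R),
        [/\ E x, E (x + gamma t) & delta * N `^ (d%:R^-1) < t].
Proof.
move=> gamma d.
pose a (k : nat) : 'rV[R]_n := \row_i (P i)`_k.+1.
have gammaE t : gamma t = \sum_(k < d) t ^+ k.+1 *: a k.
  apply/rowP => i; rewrite mxE summxE (@horner_coef_wide _ d.+1); last first.
    have : (degree (P i) <= d)%N by exact: (leq_bigmax i).
    by rewrite /degree; lia.
  rewrite big_ord_recl /= -horner_coef0 P_at0 mul0r add0r.
  by apply: eq_bigr => k _; rewrite !mxE mulrC.
pose D : R := 1 + \sum_(i < n) \sum_(k < d) `|a k 0 i|.
have D1 : 1 <= D.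
  by rewrite lerDl sumr_ge0 // => i _; rewrite sumr_ge0.
have Dle i : \sum_(k < d) `|a k 0 i| <= D.
  rewrite /D (bigD1 i) //= addrCA lerDl addr_ge0 // sumr_ge0 // => j _.
  by rewrite sumr_ge0.
(* 3 ^ n is lost in the pigeonhole and 2 ^ d in the embedding in a group *)
pose C1 : R := (d.+1 * 2 ^ d * 3 ^ n)%:R.
pose f J := (recurrence_bound d J ^ d)%N.
have fexp : double_exp f.
  by apply: double_expX (double_exp_recurrence_bound d) (single_exp_cst d).
have [c c0 hc] := double_exp_real fexp (ler0n R (d.+1 * 2 ^ d * 3 ^ n)) (le_trans ler01 D1).
exists c; split=> // eps he N N1 E mE EN Eeps delta.
have := hc eps he; rewrite -/C1 -/delta.
set J := (Num.truncn (C1 / eps)).+1 => small.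
have e0 : 0 < eps by case/andP: he.
have JC : C1 < eps * J%:R.
  rewrite mulrC -ltr_pdivrMr //.
  by have /andP[] := truncn_itv (divr_ge0 (ler0n R _ : 0 <= C1) (ltW e0)).
pose M := (recurrence_bound d J ^ d)%N.
have M0 : (0 < M)%N by rewrite expn_gt0 recurrence_bound_gt0.
pose T := N `^ (d%:R^-1).
have N0 : 0 < N by lra.
have T1 : 1 <= T by rewrite -(powRr0 N) ler_powR ?invr_ge0.
(* lam is chosen so that all coordinates of the points v z are at most N in
   absolute value *)
pose lam : R := (M%:R * D)^-1.
have MD0 : 0 < M%:R * D by rewrite mulr_gt0 ?ltr0n //; lra.
have lam0 : 0 < lam by rewrite invr_gt0.
pose eta := lam * T.
have eta0 : 0 < eta by rewrite mulr_gt0 //; lra.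
have etaX (k : 'I_d) : eta ^+ k.+1 <= lam * N.
  have lam1 : lam <= 1.
    by rewrite invf_le1 // mulr_ege1 // ler1n.
  have TN : T ^+ k.+1 <= N.
    have d0 : (0 < d)%N by apply: leq_ltn_trans (ltn_ord k).
    apply: (@le_trans _ _ (T ^+ d)); first by rewrite ler_weXn2l.
    by rewrite -powR_mulrn ?powR_ge0 // /T -powRrM mulVf ?pnatr_eq0 -?lt0n // powRr1 ?(ltW N0).
  rewrite exprMn; apply: ler_pM => //; rewrite ?exprn_ge0 //; [exact: ltW|lra|].
  by rewrite exprS ler_piMr ?exprn_ile1 ?(ltW lam0).
pose v (z : {ffun 'I_d -> 'I_M}) : 'rV[R]_n := \sum_k ((z k)%:R * eta ^+ k.+1) *: a k.
have vN z i : `|v z 0 i| <= N.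
  rewrite summxE; apply: le_trans (ler_norm_sum _ _ _) _.
  apply: (@le_trans _ _ (\sum_(k < d) (M%:R * (lam * N)) * `|a k 0 i|)).
    apply: ler_sum => k _; rewrite mxE normrM ler_wpM2r //.
    have := exprn_ge0 k.+1 (ltW eta0) => ek.
    rewrite ger0_norm ?mulr_ge0 //; apply: ler_pM => //.
    by rewrite ler_nat ltnW.
  rewrite -mulr_sumr; have := ler_wpM2l (_ : 0 <= M%:R * (lam * N)) (Dle i).
  have -> : M%:R * (lam * N) * D = N.
    by rewrite /lam; field; rewrite gt_eqF ?pnatr_eq0 -?lt0n // ?M0 //; lra.
  by apply; rewrite !mulr_ge0 // ltW.
have [x hx] : exists x : 'rV[R]_n, (d.+1 * (2 * M) ^ d < J * #|[set z | `[< E (x + v z)%R >]]%SET|)%N.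
  apply: contrapT => /forallNP none.
  pose k := (d.+1 * (2 * M) ^ d %/ J)%N.
  have /(translates_pigeonhole hn N0 mE EN Eeps vN) :
      forall x, (#|[pred z | `[< E (x + v z)%R >]]| <= k)%N.
    move=> x; rewrite leq_divRL // mulnC leqNgt; apply/negP => h; apply: (none x).
    by rewrite cardsE.
  rewrite card_ffun !card_ord => h.
  have kJ : k%:R * J%:R <= d.+1%:R * 2 ^+ d * M%:R ^+ d :> R.
    have : (k * J <= d.+1 * (2 * M) ^ d)%N by exact: leq_trunc_div.
    by rewrite -(ler_nat R) !natrM natrX natrM exprMn mulrA.
  have Md0 : 0 < M%:R ^+ d :> R by rewrite exprn_gt0 ?ltr0n.
  have : M%:R ^+ d * (eps * J%:R) <= M%:R ^+ d * C1.
    have := ler_wpM2r (exprn_ge0 n (ler0n R 3)) kJ.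
    have := ler_wpM2r (ler0n R J) h.
    rewrite /C1 (natrX _ M d) 2!natrM (natrX _ 2 d) (natrX _ 3 n).
    by move: (2 ^+ d) (3 ^+ n) (M%:R ^+ d) (k%:R) (J%:R) (d.+1%:R) => p q r s t u; lra.
  by rewrite ler_pM2l // leNgt JC.
have [m m0 [z [z' [+ + zz']]]] := recurrence_in_box (ltn0Sn _) hx.
rewrite !inE => /asboolP/asboolP Ez /asboolP/asboolP Ez'.
exists (x + v z), (m%:R * eta); split=> //.
  suff e : x + v z + gamma (m%:R * eta) = x + v z' by rewrite e.
  rewrite -addrA gammaE -big_split /=; congr (_ + _); apply: eq_bigr => k _.
  by rewrite -scalerDl zz' natrD natrX (exprMn _ m%:R) mulrDl.
apply: (@lt_le_trans _ _ eta); last by rewrite ler_peMl ?ler1n // ltW.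
rewrite /eta ltr_pM2r; last exact: lt_le_trans ltr01 T1.
by rewrite -[lam]mul1r /lam ltr_pdivlMr // [M%:R * D]mulrC mulrA.
Qed.
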